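(* Let $X$ and $Y$ be finite nonempty semimetric spaces. If $X$ and $Y$ are weakly similar, then the Hasse diagrams $\mathcal H(\mathbf{B}_X)$ and $\mathcal H(\mathbf{B}_Y)$ are isomorphic as directed graphs.
   Context: A semimetric space is a pair $(X,d)$ where $d\colon X\times X\to[0,\infty)$ satisfies $d(x,y)=d(y,x)$ and $d(x,y)=0\Leftrightarrow x=y$ for all $x,y\in X$ (no triangle inequality is assumed). Put $\operatorname{Sp}(X)=\{d(x,y)\colon x,y\in X\}$. For semimetric spaces $(X,d)$ and $(Y,\rho)$, a bijection $\Phi\colon X\to Y$ is a weak similarity if there is a strictly increasing bijection $f\colon \operatorname{Sp}(X)\to\operatorname{Sp}(Y)$ with $f(d(x,y))=\rho(\Phi(x),\Phi(y))$ for all $x,y\in X$. The spaces $X$ and $Y$ are weakly similar if a weak similarity $\Phi\colon X\to Y$ exists. A ball in $(X,d)$ is a set of the form $B_r(t)=\{x\in X\colon d(x,t)\le r\}$ with $r\ge0$ and $t\in X$. $\mathbf B_X$ denotes the set of all balls in $(X,d)$, regarded as a poset under inclusion $\subseteq$. The Hasse diagram $\mathcal H(P)$ of a finite poset $(P,\le)$ is the directed graph with vertex set $P$ in which $\langle v_1,v_2\rangle$ is an arc iff $v_1\le v_2$, $v_1\ne v_2$, and for every $w\in P$, $v_1\le w\le v_2$ implies $w=v_1$ or $w=v_2$. Two directed graphs are isomorphic if there is a bijection $F$ between their vertex sets such that $\langle x,y\rangle$ is an arc iff $\langle F(x),F(y)\rangle$ is an arc. *)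

(* Defs.v *)
From HB Require Import structures.
From mathcomp Require Import all_boot all_order all_algebra.
From mathcomp Require Import all_classical reals.

Set Implicit Arguments.
Unset Strict Implicit.
Unset Printing Implicit Defensive.

Import Order.DefaultSetSubsetOrder.
Import Order.TTheory GRing.Theory Num.Theory.
Local Open Scope ring_scope.

Definition semimetric (R : realType) (X : Type) (d : X -> X -> R) : Prop :=
  [/\ forall x y, 0 <= d x y,
      forall x y, d x y = d y x
    & forall x y, d x y = 0 <-> x = y].

Definition Sp (R : realType) (X : Type) (d : X -> X -> R) : classical_sets.set R :=
  fun r => exists x y, r = d x y.

(* The bijection f : Sp(X) -> Sp(Y) is represented by a function on R whose
   values outside Sp(X) are irrelevant. *)
Definition weak_similarity (R : realType) (X Y : Type)
    (dX : X -> X -> R) (dY : Y -> Y -> R) (Phi : X -> Y) : Prop :=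
  bijective Phi /\
  exists f : R -> R,
    [/\ set_bij (Sp dX) (Sp dY) f,
        forall s t, Sp dX s -> Sp dX t -> s < t -> f s < f t
      & forall x y, f (dX x y) = dY (Phi x) (Phi y)].

Definition weakly_similar (R : realType) (X Y : Type)
    (dX : X -> X -> R) (dY : Y -> Y -> R) : Prop :=
  exists Phi : X -> Y, weak_similarity dX dY Phi.

Definition ball (R : realType) (X : finType) (d : X -> X -> R) (r : R) (t : X)
    : {set X} :=
  [set x | d x t <= r].

Definition is_ball (R : realType) (X : finType) (d : X -> X -> R)
    : pred {set X} :=
  fun B => `[< exists (r : R) (t : X), 0 <= r /\ B = ball d r t >].

(* The subtype inherits the inclusion order on {set X}, cf. le_ballsE. *)
Record balls (R : realType) (X : finType) (d : X -> X -> R) : Type :=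
  Balls { ball_val :> {set X}; _ : is_ball d ball_val }.

HB.instance Definition _ (R : realType) (X : finType) (d : X -> X -> R) :=
  [isSub for @ball_val R X d].
HB.instance Definition _ (R : realType) (X : finType) (d : X -> X -> R) :=
  [Finite of balls d by <:].
HB.instance Definition _ (R : realType) (X : finType) (d : X -> X -> R) :=
  [SubChoice_isSubPOrder of balls d by <: with Order.SetSubsetOrder.subset_display].

Lemma le_ballsE (R : realType) (X : finType) (d : X -> X -> R) (A B : balls d) :
  (A <= B)%O = ((A : {set X}) \subset (B : {set X})).
Proof. by []. Qed.

Definition hasse (disp : Order.disp_t) (P : finPOrderType disp) : rel P :=
  fun v1 v2 =>
    [&& (v1 <= v2)%O, v1 != v2
      & [forall w, (v1 <= w <= v2)%O ==> (w == v1) || (w == v2)]].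
Arguments hasse {disp} P.

Definition digraph_isomorphic (V W : Type) (e : rel V) (e' : rel W) : Prop :=
  exists F : V -> W, bijective F /\ forall x y, e x y <-> e' (F x) (F y).

(* Main.v *)
(** In a finite space the radius of a ball can be shrunk to the largest distance
    from its center to one of its points, hence to an element of the spectrum.
    Balls with such radii are described by comparisons of distances only, which
    a weak similarity preserves in both directions; so taking images is an order
    isomorphism between the posets of balls, and Hasse diagrams depend only on
    the order. *)

Require Import Defs.
From mathcomp Require Import all_boot all_order all_algebra.
From mathcomp Require Import all_classical reals.

Set Implicit Arguments.
Unset Strict Implicit.
Unset Printing Implicit Defensive.

Import Order.TTheory GRing.Theory Num.Theory.
Local Open Scope ring_scope.

Lemma hasse_order_iso (disp disp' : Order.disp_t) (P : finPOrderType disp)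
    (Q : finPOrderType disp') (F : P -> Q) :
  bijective F -> {mono F : x y / (x <= y)%O} ->
  digraph_isomorphic (hasse P) (hasse Q).
Proof.
move=> bijF monoF; exists F; split=> // x y.
rewrite /hasse monoF (inj_eq (bij_inj bijF)).
suff -> : [forall w, (x <= w <= y)%O ==> (w == x) || (w == y)] =
          [forall w, (F x <= w <= F y)%O ==> (w == F x) || (w == F y)] by [].
have [G FK GK] := bijF.
apply/forallP/forallP => cov w.
  by have := cov (G w); rewrite -!monoF -!(inj_eq (bij_inj bijF)) GK.
by have := cov (F w); rewrite !monoF !(inj_eq (bij_inj bijF)).
Qed.

(** Eliminating [f] leaves a condition that passes to the inverse map, so a single lemma on images
    of balls serves both directions. *)
Definition same_comparisons (R : realType) (X Y : Type)
    (dX : X -> X -> R) (dY : Y -> Y -> R) (Phi : X -> Y) : Prop :=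
  forall x y z t,
    (dY (Phi x) (Phi y) <= dY (Phi z) (Phi t)) = (dX x y <= dX z t).

(** The spectrum is totally ordered, so by trichotomy the strictly increasing [f] also reflects the
    order. *)
Lemma weak_similarity_same_comparisons (R : realType) (X Y : Type)
    (dX : X -> X -> R) (dY : Y -> Y -> R) (Phi : X -> Y) :
  weak_similarity dX dY Phi -> same_comparisons dX dY Phi.
Proof.
move=> [_ [f [_ incf fE]]] x y z t; rewrite -!fE.
have Sxy : Sp dX (dX x y) by exists x, y.
have Szt : Sp dX (dX z t) by exists z, t.
have [lt_d|lt_d|->] := ltgtP (dX x y) (dX z t).
- exact/ltW/incf.
- by apply/negbTE; rewrite -ltNge; exact: incf.
- exact: lexx.
Qed.

Lemma same_comparisons_inv (R : realType) (X Y : Type)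
    (dX : X -> X -> R) (dY : Y -> Y -> R) (Phi : X -> Y) (Psi : Y -> X) :
  cancel Psi Phi -> same_comparisons dX dY Phi -> same_comparisons dY dX Psi.
Proof. by move=> PsiK cmp x y z t; rewrite -cmp !PsiK. Qed.

Lemma is_ball_imset (R : realType) (X Y : finType)
    (dX : X -> X -> R) (dY : Y -> Y -> R) (Phi : X -> Y) (B : {set X}) :
  semimetric dX -> semimetric dY -> bijective Phi ->
  same_comparisons dX dY Phi -> is_ball dX B -> is_ball dY (Phi @: B).
Proof.
move=> [_ _ dX0] [dY_ge0 _ _] [Psi PhiK PsiK] cmp.
move=> /asboolP [r [t [r_ge0 ->]]]; apply/asboolP.
(* As [r] is nonnegative, the center lies in the ball, which therefore has a point [y] farthest from
   [t]. *)
have tB : dX t t <= r by rewrite (dX0 t t).2.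
case: (@arg_maxP _ _ X t (fun x => dX x t <= r) (dX^~ t) tB) => y yB ymax.
exists (dY (Phi y) (Phi t)), (Phi t); split; first exact: dY_ge0.
apply/setP => w; rewrite -[w]PsiK (mem_imset _ _ (can_inj PhiK)) !inE cmp.
(* It remains that the radii [r] and [dX y t] cut out the same ball around [t]: maximality of [y]
   gives one inclusion, [yB] the other. *)
by apply/idP/idP => [/ymax|/le_trans]; last exact.
Qed.

Theorem theorem3p1 (R : realType) (X Y : finType)
    (dX : X -> X -> R) (dY : Y -> Y -> R)
    (semimetric_dX : semimetric dX) (semimetric_dY : semimetric dY)
    (X_nonempty : (0 < #|X|)%N) (Y_nonempty : (0 < #|Y|)%N) :
  weakly_similar dX dY ->
  digraph_isomorphic (hasse (balls dX)) (hasse (balls dY)).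
Proof.
move=> [Phi simPhi]; have [bijPhi _] := simPhi.
have cmp := weak_similarity_same_comparisons simPhi.
have [Psi PhiK PsiK] := bijPhi.
have cmpV := same_comparisons_inv PsiK cmp.
have bijPsi : bijective Psi by exists Phi.
pose F (B : balls dX) : balls dY := Balls
  (is_ball_imset semimetric_dX semimetric_dY bijPhi cmp (valP B)).
pose G (B : balls dY) : balls dX := Balls
  (is_ball_imset semimetric_dY semimetric_dX bijPsi cmpV (valP B)).
apply: (hasse_order_iso (F := F)).
  exists G => B; apply/val_inj; rewrite /= -imset_comp.
    by rewrite (eq_imset _ PhiK) imset_id.
  by rewrite (eq_imset _ PsiK) imset_id.
move=> A B; rewrite !le_ballsE /=; apply/idP/idP => [sAB|]; last exact: imsetS.
(* Injectivity of [Phi] lets inclusion of images be pulled back. *)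
apply/fintype.subsetP => x xA; rewrite -(mem_imset _ _ (can_inj PhiK)).
by rewrite (fintype.subsetP sAB) ?imset_f.
Qed.
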